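(* Let $(\xi_n)_{n\ge1}$ be a sequence of independent random variables, where $\xi_n$ takes the values $\frac12$ and $1$ with probabilities $p_{(\frac12)n}$ and $p_{(1)n}$ respectively ($p_{(\frac12)n},p_{(1)n}\ge0$, $p_{(\frac12)n}+p_{(1)n}=1$), and let $\xi=[\xi_1;\xi_2;\dots;\xi_n;\dots]$ be the random variable defined by the corresponding infinite continued fraction. The distribution of $\xi$ is discrete if and only if $$\prod_{n=1}^{+\infty}\max\left\{p_{(\frac12)n},\,p_{(1)n}\right\}>0 .$$
   Context: For a sequence $(a_n)$ of positive reals, $[a_1;a_2;\dots;a_k]$ denotes the finite continued fraction $\cfrac{1}{a_1+\cfrac{1}{a_2+\dots+\cfrac{1}{a_k}}}$, and $[a_1;a_2;\dots;a_k;\dots]=\lim_{k\to\infty}[a_1;\dots;a_k]$ (the limit exists whenever $\sum a_n$ diverges, in particular when all $a_n\in\{\frac12,1\}$). The distribution of $\xi$ is discrete if there is a countable set $C$ with $P(\xi\in C)=1$. *)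

(* Defs.v *)
From HB Require Import structures.
From mathcomp Require Import all_boot all_order all_algebra.
From mathcomp Require Import finmap.
From mathcomp Require Import all_classical all_reals all_analysis.

Set Implicit Arguments.
Unset Strict Implicit.
Unset Printing Implicit Defensive.

Import Order.TTheory GRing.Theory Num.Theory.
Import numFieldNormedType.Exports.

Local Open Scope classical_set_scope.
Local Open Scope ring_scope.

(* The empty continued fraction is 0, so that [:: a] has value 1 / a. *)
Fixpoint finite_cfrac (R : realType) (s : seq R) : R :=
  if s is a :: s' then (a + finite_cfrac s')^-1 else 0.

(* Sequences start at index 0: a 0 is the first partial denominator. *)
Definition convergent (R : realType) (a : nat -> R) (k : nat) : R :=
  finite_cfrac (mkseq a k).

(* The limit has the library's default value when it does not exist. *)
Definition infinite_cfrac (R : realType) (a : nat -> R) : R :=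
  limn (convergent a).

Definition mutually_independent (d : measure_display) (T : measurableType d)
    (R : realType) (P : probability T R) (X : nat -> {RV P >-> R}) : Prop :=
  forall (J : {fset nat}) (A : nat -> set R), (forall n, measurable (A n)) ->
    P (\bigcap_(n in [set` J]) (X n @^-1` A n)) =
    (\prod_(n <- J) P (X n @^-1` A n))%E.

(* X is not required to be measurable here: it is meant for almost sure limits
   of random variables given by limn, whose measurability is a theorem. *)
Definition discrete_distribution (d : measure_display) (T : measurableType d)
    (R : realType) (P : probability T R) (X : T -> R) : Prop :=
  exists C : set R, countable C /\ P (X @^-1` C) = 1%E.

(* Main.v *)
(* The branches x |-> 1/(1/2 + x) and x |-> 1/(1 + x) map [1/2, 1] onto [2/3, 1]
   and [1/2, 2/3], which only share 2/3, and the endpoints 1 and 1/2 have a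
   single expansion each. Hence a number has at most two expansions with digits
   1/2 and 1. An atom of xi thus forces a single sequence of digits to have
   positive probability, and that probability is at most every partial product
   of the maxima. Conversely, if the product is positive, then almost surely the
   digits eventually coincide with the most likely ones, which leaves countably
   many values. *)
Require Import Defs.
From HB Require Import structures.
From mathcomp Require Import all_boot all_order all_algebra.
From mathcomp Require Import finmap.
From mathcomp Require Import all_classical all_reals all_analysis.
From mathcomp Require Import measurable_realfun ring lra.

Set Implicit Arguments.
Unset Strict Implicit.
Unset Printing Implicit Defensive.

Import Order.TTheory GRing.Theory Num.Theory.
Import numFieldNormedType.Exports.

Local Open Scope classical_set_scope.
Local Open Scope ring_scope.

(** * Digit sequences, and finite fractions with a free tail *)

Definition shift (T : Type) (n : nat) (a : nat -> T) : nat -> T :=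
  fun i => a (n + i)%N.

Lemma shift_shift (T : Type) m n (a : nat -> T) :
  shift m (shift n a) = shift (n + m) a.
Proof. by apply/funext => i; rewrite /shift addnA. Qed.

Lemma shift0 (T : Type) (a : nat -> T) : shift 0 a = a.
Proof. by apply/funext => i; rewrite /shift add0n. Qed.

Lemma eq_head_shift (T : Type) (a b : nat -> T) :
  a 0 = b 0 -> shift 1 a = shift 1 b -> a = b.
Proof.
move=> ab0 abS; apply/funext => -[//|n].
by rewrite -[n.+1]add1n -![_ (1 + n)%N]/(shift 1 _ n) abS.
Qed.

Definition half_one (R : realType) (a : nat -> R) : Prop :=
  forall n, a n = 2^-1 \/ a n = 1.

Lemma half_one_shift (R : realType) m (a : nat -> R) :
  half_one a -> half_one (shift m a).
Proof. by move=> a_d n; exact: a_d. Qed.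

Lemma half_one_itv (R : realType) (a : nat -> R) n :
  half_one a -> 2^-1 <= a n <= 1.
Proof. by move=> /(_ n)[->|->]; apply/andP; split; lra. Qed.

(** The composition of the first [k] branches applied to [x]. Tail 0 gives a convergent; the value
    of the shifted sequence as tail gives the infinite fraction. *)
Fixpoint cfrac_tail (R : realType) (a : nat -> R) k x : R :=
  if k is k'.+1 then (a 0%N + cfrac_tail (shift 1 a) k' x)^-1 else x.

(** * Convergence and range of fractions with digits 1/2 and 1 *)

Section cfrac.
Variable R : realType.
Implicit Types (a b c : nat -> R) (x y : R).

Lemma convergentE a k : convergent a k = cfrac_tail a k 0.
Proof.
elim: k a => // k IH a; rewrite /= -IH /convergent /mkseq /=.
by rewrite -add1n iotaDl -map_comp.
Qed.

Lemma cfrac_tailD a k l x :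
  cfrac_tail a (k + l) x = cfrac_tail a k (cfrac_tail (shift k a) l x).
Proof.
elim: k a => [|k IH] a; first by rewrite shift0.
by rewrite addSn /= IH shift_shift add1n.
Qed.

(** The interval [0, 2] is stable under both branches, since 1/(1/2 + 0) = 2, and it contains the
    tail 0 of convergents, which [1/2, 1] does not. *)
Lemma cfrac_tail_itv02 a k x : half_one a ->
  0 <= x <= 2 -> 0 <= cfrac_tail a k x <= 2.
Proof.
move=> + x02; elim: k a => // k IH a a_d /=.
have /andP[t0 t2] := IH _ (half_one_shift 1 a_d).
have /andP[a0 a1] := half_one_itv 0 a_d.
apply/andP; split; first by rewrite invr_ge0; lra.
by rewrite -[leRHS]invrK lef_pV2 ?posrE; lra.
Qed.

Lemma cfrac_tail_itv a k : half_one a -> 2^-1 <= cfrac_tail a k 1 <= 1.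
Proof.
elim: k a => [|k IH] a a_d /=; first by apply/andP; split; lra.
have /andP[t0 t2] := IH _ (half_one_shift 1 a_d).
have /andP[a0 a1] := half_one_itv 0 a_d.
apply/andP; split; first by rewrite lef_pV2 ?posrE; lra.
by rewrite invf_le1; lra.
Qed.

(** One step need not contract: the slope is -4 at x = 0 for the digit 1/2. Two steps give (v +
    x)/(u(v + x) + 1), with derivative 1/(u(v + x) + 1)^2, and u(v + x) + 1 is at least 5/4; hence
    the ratio (4/5)^2. *)
Lemma two_step_contraction (u v x y : R) :
  2^-1 <= u -> 2^-1 <= v -> 0 <= x -> 0 <= y ->
  `|(u + (v + x)^-1)^-1 - (u + (v + y)^-1)^-1| <= 16 / 25 * `|x - y|.
Proof.
move=> u0 v0 x0 y0.
have D0 z : 0 <= z -> 5 / 4 <= u * (v + z) + 1 by move=> z0; nra.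
have Dx := D0 _ x0; have Dy := D0 _ y0.
have -> : (u + (v + x)^-1)^-1 - (u + (v + y)^-1)^-1 =
    ((u * (v + x) + 1) * (u * (v + y) + 1))^-1 * (x - y).
  have E z : 0 <= z -> (u + (v + z)^-1)^-1 = (v + z) / (u * (v + z) + 1).
    move=> z0; have {}Dz := D0 _ z0.
    by field; do ?[apply/andP; split]; apply: lt0r_neq0; lra.
  rewrite !E//; field.
  by apply/andP; split; apply: lt0r_neq0; lra.
rewrite normrM ler_wpM2r// ger0_norm; last first.
  by rewrite invr_ge0 mulr_ge0; lra.
rewrite -[leRHS]invrK lef_pV2 ?posrE ?mulr_gt0 ?invr_gt0//; try lra.
by rewrite invf_div; nra.
Qed.

Lemma cfrac_tail_contraction a j x y : half_one a ->
  0 <= x <= 2 -> 0 <= y <= 2 ->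
  `|cfrac_tail a j.*2 x - cfrac_tail a j.*2 y| <= 2 * (16 / 25) ^+ j.
Proof.
move=> + x02 y02; elim: j a => [|j IH] a a_d.
  by rewrite /= mulr1 ler_norml; lra.
have d2 := half_one_shift 2 a_d.
rewrite doubleS /= shift_shift.
have /andP[a0 _] := half_one_itv 0 a_d.
have /andP[a1 _] := half_one_itv 0 (half_one_shift 1 a_d).
have /andP[hx _] := cfrac_tail_itv02 j.*2 d2 x02.
have /andP[hy _] := cfrac_tail_itv02 j.*2 d2 y02.
apply: le_trans (two_step_contraction a0 a1 hx hy) _.
by rewrite exprS mulrCA ler_wpM2l ?IH//; lra.
Qed.

Lemma contraction_small (e : R) : 0 < e ->
  exists j : nat, 2 * (16 / 25) ^+ j < e.
Proof.
move=> e0; have q1 : `|16 / 25 : R| < 1 by rewrite ger0_norm; lra.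
have /cvgrPdist_lt/(_ _ e0)[j _ /(_ j (leqnn j))] := cvg_geometric 2 q1.
move=> /= jP; exists j; move: jP; rewrite sub0r normrN.
exact: le_lt_trans (ler_norm _).
Qed.

(** Every convergent of order n >= 2j is the first 2j digits applied to a tail in [0, 2], so
    contraction makes the sequence Cauchy. *)
Lemma is_cvg_convergent a : half_one a -> cvgn (convergent a).
Proof.
move=> a_d; apply/cauchy_cvgP/cauchy_exP => e e0.
have [j je] := contraction_small e0.
exists (convergent a j.*2); exists j.*2 => // n /= jn.
rewrite /ball /= (le_lt_trans _ je)// -(subnKC jn) !convergentE cfrac_tailD.
apply: cfrac_tail_contraction => //; first by apply/andP; split.
by apply: cfrac_tail_itv02; [exact: half_one_shift|apply/andP; split].
Qed.

Lemma infinite_cfracS a : half_one a ->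
  infinite_cfrac a = (a 0%N + infinite_cfrac (shift 1 a))^-1.
Proof.
move=> a_d; apply: cvg_lim => //.
have d1 := half_one_shift 1 a_d.
have /andP[a0 _] := half_one_itv 0 a_d.
rewrite -(cvg_shiftS (convergent a)).
have -> : [sequence convergent a n.+1]_n =
    (fun n => (a 0%N + convergent (shift 1 a) n)^-1).
  by apply/funext => n; rewrite /= !convergentE.
have V0 : 0 <= infinite_cfrac (shift 1 a).
  apply: limr_ge; first exact: is_cvg_convergent.
  apply: nearW => n; rewrite convergentE.
  have x0 : 0 <= (0 : R) <= (2 : R) by apply/andP; split.
  by have /andP[] := cfrac_tail_itv02 n d1 x0.
(* The limit of the denominators is at least 1/2, so inversion is continuous there. *)
apply: cvgV; first by apply: lt0r_neq0; lra.
by apply: cvgD; [exact: cvg_cst|exact: is_cvg_convergent].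
Qed.

Lemma infinite_cfrac_tail a k : half_one a ->
  infinite_cfrac a = cfrac_tail a k (infinite_cfrac (shift k a)).
Proof.
elim: k a => [|k IH] a a_d; first by rewrite shift0.
by rewrite infinite_cfracS//= IH ?shift_shift//; exact: half_one_shift.
Qed.

(** Convergents can leave [1/2, 1] (the first one may be 2), so the bounds do not come from them.
    Fractions with tail 1 stay in [1/2, 1] and, by contraction, come arbitrarily close to the
    value. *)
Lemma infinite_cfrac_itv a : half_one a -> 2^-1 <= infinite_cfrac a <= 1.
Proof.
move=> a_d.
have V02 b : half_one b -> 0 <= infinite_cfrac b <= 2.
  move=> b_d; have x0 : 0 <= (0 : R) <= (2 : R) by apply/andP; split.
  have cb := is_cvg_convergent b_d.
  apply/andP; split; [apply: limr_ge => //|apply: limr_le => //];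
    apply: nearW => n; rewrite convergentE;
    by have /andP[] := cfrac_tail_itv02 n b_d x0.
suff close e : 0 < e ->
    2^-1 <= infinite_cfrac a + e /\ infinite_cfrac a <= 1 + e.
  by apply/andP; split; apply/ler_addgt0Pr => e /close[].
move=> /contraction_small[j je].
have x1 : 0 <= (1 : R) <= (2 : R) by apply/andP; split; lra.
have := cfrac_tail_contraction j a_d (V02 _ (half_one_shift j.*2 a_d)) x1.
rewrite -infinite_cfrac_tail// ler_norml => /andP[h1 h2].
have /andP[h3 h4] := cfrac_tail_itv j.*2 a_d.
by split; lra.
Qed.

(* The images of [1/2, 1] under the two branches are [2/3, 1] and [1/2, 2/3]:
   they only meet at 2/3. *)
Lemma infinite_cfrac_head a : half_one a ->
  [\/ [/\ a 0%N = 2^-1, 2 / 3 <= infinite_cfrac a &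
        infinite_cfrac (shift 1 a) = (infinite_cfrac a)^-1 - 2^-1] |
      [/\ a 0%N = 1, infinite_cfrac a <= 2 / 3 &
        infinite_cfrac (shift 1 a) = (infinite_cfrac a)^-1 - 1]].
Proof.
move=> a_d; have E := infinite_cfracS a_d.
have /andP[t0 t1] := infinite_cfrac_itv (half_one_shift 1 a_d).
have [a0|a0] := a_d 0%N; [left|right]; split => //.
- by rewrite E a0 -[leLHS]invrK lef_pV2 ?posrE ?invf_div; lra.
- by rewrite E a0 invrK addrAC subrr add0r.
- by rewrite E a0 -[leRHS]invrK lef_pV2 ?posrE ?invf_div; lra.
- by rewrite E a0 invrK addrAC subrr add0r.
Qed.

(** * Numbers with several expansions *)

(** The endpoint 1 forces the digit 1/2 and leaves 1/2; the endpoint 1/2 forces the digit 1 and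
    leaves 1. The endpoints thus alternate and every digit is forced. *)
Lemma infinite_cfrac_endpoint_inj a b : half_one a -> half_one b ->
  infinite_cfrac a = infinite_cfrac b ->
  infinite_cfrac a = 1 \/ infinite_cfrac a = 2^-1 -> a = b.
Proof.
move=> a_d b_d ab e; apply/funext => n.
elim: n a b a_d b_d ab e => [|n IH] a b a_d b_d ab e.
  have := infinite_cfrac_head a_d; have := infinite_cfrac_head b_d.
  rewrite -ab; case: e => ->.
    by move=> [[-> ? ?]|[? ? ?]]; last lra; move=> [[-> ? ?]|[? ? ?]]//; lra.
  by move=> [[? ? ?]|[-> ? ?]]; first lra; move=> [[? ? ?]|[-> ? ?]]//; lra.
rewrite -[n.+1]add1n -![_ (1 + n)%N]/(shift 1 _ n).
have := infinite_cfrac_head a_d; have := infinite_cfrac_head b_d.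
rewrite -ab => hb ha.
by apply: IH; try exact: half_one_shift; case: e ha hb => ->;
  move=> [[_ ? Ea]|[_ ? Ea]] [[_ ? Eb]|[_ ? Eb]]; rewrite ?Ea ?Eb ?invrK ?invr1;
  first [lra | left; lra | right; lra].
Qed.

(** Different first digits force the common value 2/3. What remains after the first digit is 1 or
    1/2, an endpoint, so the first digit determines the rest. *)
Lemma infinite_cfrac_branch a b : half_one a -> half_one b ->
  infinite_cfrac a = infinite_cfrac b -> a 0%N <> b 0%N ->
  forall c, half_one c -> infinite_cfrac c = infinite_cfrac a ->
  c 0%N = a 0%N -> c = a.
Proof.
move=> a_d b_d ab ne c c_d ca c0; apply: eq_head_shift => //.
have := infinite_cfrac_head c_d; have := infinite_cfrac_head a_d.
have := infinite_cfrac_head b_d; rewrite -ab ca.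
move=> [[b0 ? sb]|[b0 ? sb]] [[a0 ? sa]|[a0 ? sa]] [[c0' ? sc]|[c0' ? sc]];
  try (by rewrite a0 b0 in ne); try (by exfalso; lra).
all: apply: infinite_cfrac_endpoint_inj; try exact: half_one_shift;
  rewrite ?sa ?sc//; have -> : infinite_cfrac a = 2 / 3 by lra.
all: rewrite invf_div; first [left; lra | right; lra].
Qed.

Lemma infinite_cfrac_two_expansions n a b c :
  half_one a -> half_one b -> half_one c ->
  infinite_cfrac a = infinite_cfrac b -> infinite_cfrac c = infinite_cfrac a ->
  (forall i, (i < n)%N -> a i = b i) -> a n <> b n -> c = a \/ c = b.
Proof.
elim: n a b c => [|n IH] a b c a_d b_d c_d ab ca eqn ne.
  have [c0|c0] : c 0%N = a 0%N \/ c 0%N = b 0%N.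
    by case: (a_d 0%N) (b_d 0%N) (c_d 0%N) ne => -> [->|->] [->|->] ne;
      [left|case: ne|left|right|right|left|case: ne|left].
  - by left; exact: (@infinite_cfrac_branch a b).
  - by right; apply: (infinite_cfrac_branch b_d a_d _ (nesym ne)) => //;
      rewrite ca.
(* Here [a] and [b] share their first digit. If [c] had the other one, the first digit would
   determine the expansion, giving [b = a]. *)
have [ca0|ca0] := pselect (c 0%N = a 0%N); last first.
  have ab' : b = a.
    apply: (@infinite_cfrac_branch a c) => //; [exact/nesym|].
    by rewrite eqn.
  by rewrite ab' in ne.
have ba0 : b 0%N = a 0%N by rewrite eqn.
have S d : half_one d -> infinite_cfrac d = infinite_cfrac a -> d 0%N = a 0%N ->
    infinite_cfrac (shift 1 d) = (infinite_cfrac a)^-1 - a 0%N.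
  by move=> d_d <- <-; rewrite (infinite_cfracS d_d) invrK addrAC subrr add0r.
have [E|E] : shift 1 c = shift 1 a \/ shift 1 c = shift 1 b.
- apply: IH; try exact: half_one_shift; rewrite ?S//.
  by move=> i ni; apply: eqn.
- by left; exact: eq_head_shift.
- by right; apply: eq_head_shift => //; rewrite ca0.
Qed.

(** The sequences [s] and [t] may coincide, and are arbitrary when [x] has no expansion. Otherwise
    two distinct expansions are compared at the first index where they differ. *)
Lemma infinite_cfrac_fiber x : exists s t, [/\ half_one s, half_one t &
  forall a, half_one a -> infinite_cfrac a = x -> a = s \/ a = t].
Proof.
have one_d : half_one (fun=> 1 : R) by move=> n; right.
have [[s [s_d sx]]|nos] :=
    pselect (exists s, half_one s /\ infinite_cfrac s = x); last first.
  by exists (fun=> 1), (fun=> 1); split => // a a_d ax; case: nos; exists a.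
have [[t [t_d [tx st]]]|not] :=
    pselect (exists t, half_one t /\ infinite_cfrac t = x /\ s <> t); last first.
  exists s, s; split => // a a_d ax; left.
  by apply: contrapT => /nesym sa; apply: not; exists a.
exists s, t; split => // a a_d ax.
have ex : exists n, s n != t n.
  by apply: contrapT => /forallNP h; apply: st; apply/funext => n;
    apply/eqP; move/negP: (h n); rewrite negbK.
case: (ex_minnP ex) => n /eqP ne n_min.
apply: (@infinite_cfrac_two_expansions n) => //; rewrite ?sx ?tx ?ax//.
by move=> i ni; apply/eqP; apply: contraTT ni => /n_min; rewrite -leqNgt.
Qed.

End cfrac.

(** * Measurability of limits and of the infinite fraction *)

Lemma measurable_invr (R : realType) : measurable_fun [set: R] (@GRing.inv R).
Proof.
have -> : [set: R] = [set 0] `|` ~` [set 0].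
  by rewrite setUv.
apply/measurable_funU => //; first exact: measurableC.
split.
  (* The inverse of 0 is 0 by convention; away from 0 inversion is continuous. *)
  apply: (@eq_measurable_fun _ _ _ _ _ (cst (0 : R))) => // x.
  by rewrite inE => ->; rewrite invr0.
apply: open_continuous_measurable_fun.
  exact/closed_openC/accessible_closed_set1/hausdorff_accessible/Rhausdorff.
by move=> x; rewrite inE => /= /eqP x0; exact: inv_continuous.
Qed.

(** The Cauchy criterion with quantifiers over naturals only, so that the convergence set becomes
    countable unions and intersections. *)
Lemma is_cvgn_natP (R : realType) (u : nat -> R) : cvgn u <->
  forall k : nat, exists N, forall n, (N <= n)%N -> `|u N - u n| < k.+1%:R^-1.
Proof.
split=> [cu k|h].
  have k0 : 0 < k.+1%:R^-1 / 2 :> R by rewrite divr_gt0// invr_gt0.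
  have /cvgrPdist_lt/(_ _ k0)[N _ NP] := cu.
  exists N => n Nn; have /= h1 := NP _ Nn; have /= h2 := NP _ (leqnn N).
  rewrite -(subrKA (limn u)) [ltRHS]splitr (le_lt_trans (ler_normD _ _))//.
  by rewrite ltrD// distrC.
apply/cauchy_cvgP/cauchy_exP => _/posnumP[e].
have [k _ ke] := near_infty_natSinv_lt e.
have [N NP] := h k; exists (u N); exists N => // n /= Nn.
by rewrite /ball /= (lt_trans (NP _ Nn))//; exact: (ke k (leqnn k)).
Qed.

Lemma measurable_is_cvgn d (T : measurableType d) (R : realType)
    (h : nat -> T -> R) : (forall n, measurable_fun [set: T] (h n)) ->
  measurable [set w | cvgn (h ^~ w)].
Proof.
move=> mh.
have -> : [set w | cvgn (h ^~ w)] =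
    \bigcap_k \bigcup_N \bigcap_(n in [set n | N <= n]%N)
      [set w | `|h N w - h n w| < k.+1%:R^-1].
  apply/seteqP; split => w /=.
    by move=> /is_cvgn_natP hw k _; have [N NP] := hw k; exists N => // n /NP.
  by move=> hw; apply/is_cvgn_natP => k; have [N] := hw k Logic.I; exists N.
apply: bigcapT_measurable => k; apply: bigcupT_measurable => N.
apply: bigcap_measurableType => n _.
rewrite -[X in measurable X]setTI.
have mlt := @measurable_fun_ltr _ T R setT
  (fun w => `|h N w - h n w|) (cst k.+1%:R^-1).
 apply: (mlt _ _ measurableT [set true]) => //.
by apply: measurableT_comp => //; exact: measurable_funB.
Qed.

Lemma measurable_fun_limn d (T : measurableType d) (R : realType)
    (h : nat -> T -> R) : (forall n, measurable_fun [set: T] (h n)) ->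
  measurable_fun [set: T] (fun w => limn (h ^~ w)).
Proof.
move=> mh; have mD := measurable_is_cvgn mh.
rewrite -(setUv [set w | cvgn (h ^~ w)]).
apply/measurable_funU => //; first exact: measurableC.
split.
  by apply: (measurable_fun_cvg (h := h)) => // n; exact: measurable_funTS.
(* Where the sequence diverges, [limn] is the constant default value. *)
apply: (eq_measurable_fun (cst point)) => // w; rewrite inE => /= ncvg.
by rewrite dvgP.
Qed.

Lemma measurable_infinite_cfrac d (T : measurableType d) (R : realType)
    (f : nat -> T -> R) : (forall n, measurable_fun [set: T] (f n)) ->
  measurable_fun [set: T] (fun w => infinite_cfrac (f ^~ w)).
Proof.
move=> mf.
apply: (measurable_fun_limn (h := fun k w => convergent (f ^~ w) k)) => k.
rewrite (_ : (fun w => _) = fun w => cfrac_tail (f ^~ w) k 0); last first.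
  by apply/funext => w; rewrite convergentE.
elim: k f mf => [|k IH] f mf /=; first exact: measurable_cst.
apply: measurableT_comp; first exact: measurable_invr.
apply: measurable_funD => //.
by apply: (IH (fun n => f n.+1)) => n.
Qed.

Lemma mutually_independent_nat_itv (d : measure_display) (T : measurableType d)
    (R : realType) (P : probability T R) (X : nat -> {RV P >-> R})
    (A : nat -> set R) (M N : nat) :
  mutually_independent X -> (forall n, measurable (A n)) ->
  P (\bigcap_(n in [set n | (M <= n < N)%N]) (X n @^-1` A n)) =
  (\prod_(M <= n < N) P (X n @^-1` A n))%E.
Proof.
move=> X_indep mA.
have := X_indep (seq_fset tt (index_iota M N)) A mA.
have -> : [set` seq_fset tt (index_iota M N)] = [set n | (M <= n < N)%N].
  have e n : (n \in seq_fset tt (index_iota M N)) = (M <= n < N)%N.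
    by rewrite seq_fsetE mem_index_iota.
  by apply/seteqP; split => n /= nJ; [rewrite -e|move: nJ; rewrite -e].
move=> ->; apply: perm_big.
by rewrite (perm_trans (seq_fset_perm _ _))// undup_id// iota_uniq.
Qed.

(** * Random digits: a discrete law forces a positive product *)

Section random_digits.
Variables (d : measure_display) (T : measurableType d) (R : realType).
Variables (P : probability T R) (xi : nat -> {RV P >-> R}).
Variables (p_half p_one : nat -> R).
Hypothesis p_half_ge0 : forall n, 0 <= p_half n.
Hypothesis p_one_ge0 : forall n, 0 <= p_one n.
Hypothesis p_sum1 : forall n, p_half n + p_one n = 1.
Hypothesis xi_half : forall n, P (xi n @^-1` [set 2^-1]) = (p_half n)%:E.
Hypothesis xi_one : forall n, P (xi n @^-1` [set 1]) = (p_one n)%:E.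
Hypothesis xi_indep : mutually_independent xi.

Let X w := infinite_cfrac (fun n => xi n w).

Let q n := Num.max (p_half n) (p_one n).

Let Q N := \prod_(n < N) q n.

(** The hypotheses fix probabilities only, so a digit may take other values on a null event; [good]
    excludes this. *)
Let good : set T := [set w | half_one (fun n => xi n w)].

Let agree (s : nat -> R) : set T := [set w | forall n, xi n w = s n].

Let q_ge0 n : 0 <= q n.
Proof. by rewrite le_max p_half_ge0. Qed.

Let q_le1 n : q n <= 1.
Proof. by rewrite ge_max -(p_sum1 n) lerDl lerDr p_half_ge0 p_one_ge0. Qed.

Let Q_ge0 N : 0 <= Q N.
Proof. exact: prodr_ge0. Qed.

Let Q_noninc : {homo Q : m n / (m <= n)%N >-> n <= m}.
Proof.
apply/nonincreasing_seqP => n.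
by rewrite /Q big_ord_recr/= ler_piMr// Q_ge0.
Qed.

Let is_cvg_Q : cvgn Q.
Proof.
apply: nonincreasing_is_cvgn Q_noninc _.
by exists 0 => _ [N _ <-]; exact: Q_ge0.
Qed.

Let measurable_xi n (A : set R) : measurable A -> measurable (xi n @^-1` A).
Proof.
by move=> mA; rewrite -[X in measurable X]setTI; exact: measurable_funP.
Qed.

Let prob_digit_le s n : half_one s -> (P (xi n @^-1` [set s n]) <= (q n)%:E)%E.
Proof.
by move=> /(_ n)[->|->]; rewrite ?xi_half ?xi_one lee_fin le_max lexx ?orbT.
Qed.

(* [P] need not be complete, so measurability matters also on the null event
   where some digit is neither 1/2 nor 1 and the fraction may diverge. *)
Let measurable_preimage_countable (C : set R) :
  countable C -> measurable (X @^-1` C).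
Proof.
move=> cC; rewrite -[X in measurable X]setTI.
apply: (measurable_infinite_cfrac (f := fun n => xi n)) => //.
exact: countable_measurable.
Qed.

Let measurable_agree s : measurable (agree s).
Proof.
have -> : agree s = \bigcap_n (xi n @^-1` [set s n]).
  by apply/seteqP; split => w h n; [move=> _; exact: h|exact: (h n Logic.I)].
by apply: bigcapT_measurable => n; exact: measurable_xi.
Qed.

Let negligible_bad : P.-negligible (~` good).
Proof.
have -> : ~` good = \bigcup_n ~` (xi n @^-1` [set 2^-1; 1]).
  rewrite -setC_bigcap; congr (~` _).
  by apply/seteqP; split => w h n; [move=> _; exact: h|exact: (h n Logic.I)].
apply: negligible_bigcup => n.
have mU : measurable (xi n @^-1` [set 2^-1; 1]).
  by apply: measurable_xi; exact: measurableU.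
apply/negligibleP; first exact: measurableC.
have disj : xi n @^-1` [set 2^-1] `&` xi n @^-1` [set 1] = set0.
  by apply/seteqP; split => // w [/= -> h]; lra.
have PU : P (xi n @^-1` [set 2^-1; 1]) = 1%E.
  transitivity (P (xi n @^-1` [set 2^-1%R]) + P (xi n @^-1` [set 1%R]))%E.
    by rewrite preimage_setU; apply: measureU => //; exact: measurable_xi.
  by rewrite xi_half xi_one -EFinD p_sum1.
by apply: (etrans (probability_setC _ mU)); rewrite PU subee.
Qed.

(** By independence, the first [N] digits follow [s] with a probability that is a product of factors
    at most [q n]. *)
Let agree_le s N : half_one s -> (P (agree s) <= (Q N)%:E)%E.
Proof.
move=> s_d.
pose F := \bigcap_(n in [set n | (0 <= n < N)%N]) (xi n @^-1` [set s n]).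
have mF : measurable F.
  by apply: bigcap_measurableType => n _; exact: measurable_xi.
apply: (@le_trans _ _ (P F)).
  by apply: le_measure; rewrite ?inE// => w h n _; exact: h.
rewrite /F (mutually_independent_nat_itv 0 N xi_indep
  (A := fun n => [set s n]))//.
have fin n : P (xi n @^-1` [set s n]) \is a fin_num.
  by apply: fin_num_measure; exact: measurable_xi.
rewrite (eq_bigr (fun n => (fine (P (xi n @^-1` [set s n])))%:E)); last first.
  by move=> n _; rewrite fineK.
rewrite prodEFin lee_fin /Q -(big_mkord xpredT q).
apply: ler_prod => n _; rewrite fine_ge0//=.
by rewrite -lee_fin fineK// prob_digit_le.
Qed.

Let negligible_agree s : limn Q <= 0 -> half_one s -> P.-negligible (agree s).
Proof.
move=> Q0 s_d; suff P0 : P (agree s) = 0%E by exact/negligibleP.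
have fin : P (agree s) \is a fin_num by exact: fin_num_measure.
apply/le_anti/andP; split; last exact: measure_ge0.
rewrite -(fineK fin) lee_fin (le_trans _ Q0)//.
apply: limr_ge => //; apply: nearW => N.
by rewrite -lee_fin fineK// agree_le.
Qed.

(** If the product vanished, each digit sequence would be null, hence each fiber, being two
    sequences up to a null event, and then the preimage of a countable set. *)
Lemma discrete_lim_gt0 : discrete_distribution P X -> 0 < limn Q.
Proof.
move=> [C [cC PC]]; rewrite ltNge; apply/negP => Q0.
(* The enumeration [g] covers [C] but may take values outside it, so an empty [C] needs no separate
   case. *)
have [g gC] := pcard_surjP cC.
have mXC := measurable_preimage_countable cC.
suff XCn : P.-negligible (X @^-1` C).
  have XC0 : P (X @^-1` C) = 0%E by exact/negligibleP.
  by move: PC; rewrite XC0 => -[] /eqP; rewrite eq_sym oner_eq0.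
pose fiber k := good `&` X @^-1` [set g k].
apply: (@negligibleS _ _ _ _ (~` good `|` \bigcup_k fiber k)).
  move=> w Cw; have [w_good|] := pselect (good w); [right|by left].
  by have [k _ gk] := gC _ Cw; exists k.
apply: negligibleU => //; apply: negligible_bigcup => k.
have [s [t [s_d t_d st]]] := infinite_cfrac_fiber (g k).
apply: (@negligibleS _ _ _ _ (agree s `|` agree t)).
  by move=> w [w_good /st]/(_ w_good)[E|E]; [left|right] => n; rewrite -E.
by apply: negligibleU; exact: negligible_agree.
Qed.

(** * A positive product gives a discrete law *)

Let m n : R := if p_one n <= p_half n then 2^-1 else 1.

Let prob_m n : P (xi n @^-1` [set m n]) = (q n)%:E.
Proof.
rewrite /m /q; case: leP => h; first by rewrite xi_half.
by rewrite xi_one.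
Qed.

(** Sequences that eventually follow [m] are coded by finite boolean words, [true] for 1 and [false]
    for 1/2, which makes the values countable. *)
Let value (s : seq bool) : R := infinite_cfrac
  (fun n => if (n < size s)%N
            then (if nth false s n then 1 else 2^-1) else m n).

Let tail N : set T := [set w | forall n, (N <= n)%N -> xi n w = m n].

Let measurable_tail N : measurable (tail N).
Proof.
have -> : tail N = \bigcap_(n in [set n | (N <= n)%N]) (xi n @^-1` [set m n]).
  by apply/seteqP; split => w h n => [|Nn]; exact: h.
by apply: bigcap_measurableType => n _; exact: measurable_xi.
Qed.

Let tail_good_value N w : tail N w -> good w -> range value (X w).
Proof.
move=> w_tail w_good; exists (mkseq (fun n => xi n w == 1) N) => //.
congr infinite_cfrac; apply/funext => n; rewrite size_mkseq.
case: ltnP => [nN|/w_tail//]; rewrite nth_mkseq//.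
by case: eqP => // n1; case: (w_good n).
Qed.

(** The probability of [tail N] is the product of the [q n] for n >= N; multiplying by [Q N] avoids
    a quotient. *)
Let lim_le_tail N : limn Q <= fine (P (tail N)) * Q N.
Proof.
pose F M := \bigcap_(n in [set n | (N <= n < N + M)%N]) (xi n @^-1` [set m n]).
have mF M : measurable (F M).
  by apply: bigcap_measurableType => n _; exact: measurable_xi.
have FE : \bigcap_M F M = tail N.
  apply/seteqP; split => w h.
    (* The block [F M] stops before N + M, so n - N + 1 is the least length reaching [n]. *)
    move=> n Nn; apply: (h (n - N).+1 Logic.I) => /=.
    by rewrite Nn addnS subnKC/=.
  by move=> M _ n /= /andP[Nn _]; exact: h.
have PF M : P (F M) = (\prod_(N <= n < N + M) q n)%:E.
  rewrite /F (mutually_independent_nat_itv _ _ xi_indep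
    (A := fun n => [set m n]))//.
  by rewrite (eq_bigr (fun n => (q n)%:E)) ?prodEFin// => n _; exact: prob_m.
(* Continuity from above along the decreasing events [F M]. *)
have cF : P (F M) @[M --> \oo] --> P (tail N).
  rewrite -FE; apply: nonincreasing_cvg_mu => //.
  - by rewrite (le_lt_trans (probability_le1 _ _)) ?ltry.
  - by rewrite FE.
  - move=> M1 M2 M12; apply/subsetPset => w h n /= /andP[Nn nM].
    by apply: h; rewrite /= Nn (leq_trans nM)// leq_add2l.
have fin : P (tail N) \is a fin_num by exact: fin_num_measure.
have /cvg_lim <- // : fine (P (F M)) * Q N @[M --> \oo] -->
    fine (P (tail N)) * Q N.
  by apply: cvgMl; apply: fine_cvg; rewrite fineK.
apply: limr_ge.
  apply: is_cvgMl; apply/cvg_ex; exists (fine (P (tail N))).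
  by apply: fine_cvg; rewrite fineK.
(* The two products join into [Q (N + M)], which is at least the limit. *)
apply: nearW => M; rewrite PF /= mulrC /Q -!(big_mkord xpredT q).
rewrite -big_cat_nat ?leq_addr//= (big_mkord xpredT q).
exact: nonincreasing_cvgn_ge.
Qed.

(** Let p be the probability of the countable set of values. It bounds that of each [tail N], so lim
    Q <= p Q(N). Letting N grow and cancelling lim Q > 0 gives p >= 1. *)
Lemma lim_gt0_discrete : 0 < limn Q -> discrete_distribution P X.
Proof.
move=> Q0; exists (range value).
have cV : countable (range value).
  by apply: card_le_trans (card_image_le _ _) _; exact: countableP.
split => //; have mV := measurable_preimage_countable cV.
have fin : P (X @^-1` range value) \is a fin_num by exact: fin_num_measure.
apply/le_anti/andP; split; first exact: probability_le1.
rewrite -(fineK fin) lee_fin -(ler_pM2r Q0) mul1r.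
have cQ : fine (P (X @^-1` range value)) * Q N @[N --> \oo] -->
    fine (P (X @^-1` range value)) * limn Q by exact: cvgMr.
rewrite -(cvg_lim _ cQ)//; apply: limr_ge.
  by apply/cvg_ex; eexists; exact: cQ.
apply: nearW => N; apply: (le_trans (lim_le_tail N)); apply: ler_wpM2r => //.
(* A measurable null set [B] stands in for the complement of [good], so that monotonicity and
   additivity of [P] apply. *)
have [B [mB B0 badB]] := negligible_bad.
apply: fine_le; [exact: fin_num_measure|exact: fin_num_measure|].
apply: (@le_trans _ _ (P (X @^-1` range value `|` B))).
  apply: le_measure; rewrite ?inE//; first exact: measurableU.
  move=> w w_tail; have [w_good|/badB] := pselect (good w); last by right.
  by left; exact: tail_good_value w_tail w_good.
by rewrite measureU0.
Qed.

End random_digits.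

Theorem theorem3 (d : measure_display) (T : measurableType d) (R : realType)
    (P : probability T R) (xi : nat -> {RV P >-> R}) (p_half p_one : nat -> R)
    (p_half_ge0 : forall n, 0 <= p_half n)
    (p_one_ge0 : forall n, 0 <= p_one n)
    (p_sum1 : forall n, p_half n + p_one n = 1)
    (xi_half : forall n, P (xi n @^-1` [set 2^-1]) = (p_half n)%:E)
    (xi_one : forall n, P (xi n @^-1` [set 1]) = (p_one n)%:E)
    (xi_indep : mutually_independent xi) :
  discrete_distribution P (fun w => infinite_cfrac (fun n => xi n w)) <->
  0 < limn (fun N => \prod_(n < N) Num.max (p_half n) (p_one n)).
Proof.
split; first exact: discrete_lim_gt0.
exact: (lim_gt0_discrete p_half_ge0 p_one_ge0 p_sum1 xi_half xi_one xi_indep).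
Qed.
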